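(* For $\tau\in\mathbb H$ and $q=e^{2\pi i\tau}$ (so $|q|<1$), $$f_{31}(\tau)=q\,J_1J_{31}\,U(1,31),\qquad \Phi(\tau)=q^{-1/3}\,U(1,31).$$
   Context: Here $\mathbb H=\{z\in\mathbb C:\operatorname{Im}z>0\}$, fractional powers mean $q^c=e^{2\pi ic\tau}$, $(x;q)_n=\prod_{j=0}^{n-1}(1-xq^j)$, $J_d=\prod_{j\ge1}(1-q^{dj})$, and $\eta(\tau)=q^{1/24}\prod_{j\ge1}(1-q^j)$. The Rogers–Ramanujan functions are $$\mathcal G(q)=\sum_{n\ge0}\frac{q^{n^2}}{(q;q)_n},\qquad \mathcal H(q)=\sum_{n\ge0}\frac{q^{n^2+n}}{(q;q)_n},$$ and $U(1,31)=\mathcal H(q)\mathcal G(q^{31})-q^6\mathcal G(q)\mathcal H(q^{31})$. Further $$\Theta_{a,b,c}(\tau)=\sum_{u,v\in\mathbb Z}q^{au^2+buv+cv^2},\quad f_{31}=\frac{\Theta_{1,1,8}-\Theta_{2,1,4}}2,\quad \Phi(\tau)=\frac{f_{31}(\tau)}{\eta(\tau)\eta(31\tau)}.$$ *)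

(* Defs.v *)
From HB Require Import structures.
From mathcomp Require Import all_boot all_order all_algebra.
From mathcomp Require Import complex.
From mathcomp Require Import all_classical all_reals all_analysis.
From mathcomp.analysis Require Import showcase.summability.

Set Implicit Arguments.
Unset Strict Implicit.
Unset Printing Implicit Defensive.

Import Order.TTheory GRing.Theory Num.Theory.
Import numFieldNormedType.Exports.

Local Open Scope classical_set_scope.
Local Open Scope ring_scope.
Local Open Scope complex_scope.

(* R[i] itself carries no topology in the library; the regular module R[i]^o
   is the same field with the topology of its modulus.  [lim] and [sum] take
   a dummy value when there is no convergence; for |q| < 1 every limit, product
   and double series below converges. *)

Definition cexp (R : realType) (z : R[i]) : R[i] :=
  (expR (complex.Re z))%:C * (cos (complex.Im z) +i* sin (complex.Im z)).

(* q ^ c is a function of tau: for non-integral c it is not determined by q. *)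
Definition qpow (R : realType) (c : R) (tau : R[i]) : R[i] :=
  cexp ((0 +i* (2 * pi * c)) * tau).

Definition nome (R : realType) (tau : R[i]) : R[i] := qpow 1 tau.

Definition qpochhammer (R : realType) (x q : R[i]) (n : nat) : R[i] :=
  \prod_(0 <= j < n) (1 - x * q ^+ j).

Definition rrG (R : realType) (q : R[i]) : R[i] :=
  lim (series (fun n => q ^+ (n ^ 2) / qpochhammer q q n : R[i]^o) @ \oo).

Definition rrH (R : realType) (q : R[i]) : R[i] :=
  lim (series (fun n => q ^+ (n ^ 2 + n) / qpochhammer q q n : R[i]^o) @ \oo).

Definition J (R : realType) (d : nat) (q : R[i]) : R[i] :=
  lim ((fun n => \prod_(1 <= j < n.+1) (1 - q ^+ (d * j)) : R[i]^o) @ \oo).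

Definition U1_31 (R : realType) (q : R[i]) : R[i] :=
  rrH q * rrG (q ^+ 31) - q ^+ 6 * rrG q * rrH (q ^+ 31).

Definition eta (R : realType) (tau : R[i]) : R[i] :=
  qpow 24^-1 tau *
  lim ((fun n => \prod_(1 <= j < n.+1) (1 - nome tau ^+ j) : R[i]^o) @ \oo).

(* The double series is the unordered sum over Z x Z, i.e. the limit of its
   finite partial sums along the filter of finite subsets.  The exponent is an
   integer, so the power is the integer power in the field R[i]. *)
Definition Theta (R : realType) (a b c : int) (tau : R[i]) : R[i] :=
  sum (fun w : int * int =>
    nome tau ^ (a * w.1 ^+ 2 + b * w.1 * w.2 + c * w.2 ^+ 2) : R[i]^o).

Definition f31 (R : realType) (tau : R[i]) : R[i] :=
  (Theta 1 1 8 tau - Theta 2 1 4 tau) / 2.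

Definition Phi (R : realType) (tau : R[i]) : R[i] :=
  f31 tau / (eta tau * eta (31 * tau)).

(* Main.v *)
(** Write (q)_n = (1 - q) ... (1 - q^n).  For e = 0, 1, the limit of an identity
    obtained by iterating Bailey's lemma twice is the Rogers-Ramanujan identity
      J_1 sum_(n >= 0) q^(n^2 + e n) / (q)_n =
        sum_(r in Z) (-1)^r q^(r (r - 1) / 2 + 2 r (r + e)),
    so q J_1 J_31 U(1, 31) is a difference of two signed sums of
    q^((x^2 + 31 y^2) / 40), the first over (x, y) = (3, -1) mod 10 and the second
    over (x, y) = (-1, 3) mod 10.  Since 9 + 31 = 40 and 169 + 31 = 5 * 40, the
    theta series of u^2 + u v + 8 v^2 and 2 u^2 + u v + 4 v^2 are the sums of
    q^((x^2 + 31 y^2) / 40) over the lattices x = 3 y mod 20 and x = 13 y mod 20.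
    Averaging over the signs of x and y reduces the theorem to an identity between
    functions of (x, y) mod 20. *)

Require Import Defs.
From HB Require Import structures.
From mathcomp Require Import all_boot all_order all_algebra finmap.
From mathcomp Require Import complex ring lra zify.
From mathcomp Require Import all_classical all_reals all_analysis.
From mathcomp.analysis Require Import showcase.summability.

Import Order.TTheory GRing.Theory Num.Theory.
Import numFieldNormedType.Exports.
Local Open Scope fset_scope.
Local Open Scope classical_set_scope.
Local Open Scope ring_scope.
Local Open Scope complex_scope.

(** * Unordered sums *)

#[local] Existing Instance totally_filter.

(** As a relation this asserts convergence together with the value, whereas [sum] alone returns a
    default when there is no limit. *)
Definition has_sum {I : choiceType} {K : numFieldType} {V : normedModType K}
    (f : I -> V) (l : V) :=
  partial_sum f A @[A --> totally] --> l.

Section HasSum.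
Context {I : choiceType} {K : numFieldType} {V : normedModType K}.
Implicit Types (f g : I -> V) (l : V).

Lemma partial_sumE f (A : {fset I}) : partial_sum f A = \sum_(i <- A) f i.
Proof. by rewrite /partial_sum big_seq_fsetE. Qed.

Lemma partial_sum_seq f (s : seq I) :
  uniq s -> partial_sum f [fset x in s] = \sum_(i <- s) f i.
Proof.
move=> us; rewrite partial_sumE; apply: perm_big; apply: uniq_perm => //.
by move=> x; rewrite in_fset.
Qed.

Lemma has_sumP f l : has_sum f l <->
  (forall e : K, 0 < e -> exists A0 : {fset I}, forall A,
     A0 `<=` A -> `|l - partial_sum f A| < e)%fset.
Proof.
split=> [fl e e0|fl].
  have [A0 _ A0P] := cvgr_dist_lt _ _ fl _ e0.
  by exists A0 => A /A0P.
apply/cvgrPdist_lt => e e0; have [A0 A0P] := fl e e0.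
exists A0 => // A; exact: A0P.
Qed.

Lemma has_sum_unique f l l' : has_sum f l -> has_sum f l' -> l = l'.
Proof. exact: cvg_unique. Qed.

Lemma sum_has_sum f l : has_sum f l -> sum f = l.
Proof. exact: cvg_lim. Qed.

Lemma has_sumD f g l m : has_sum f l -> has_sum g m ->
  has_sum (fun i => f i + g i) (l + m).
Proof.
move=> fl gm; rewrite /has_sum.
under eq_fun do rewrite /partial_sum big_split.
exact: (cvgD fl gm).
Qed.

Lemma has_sumN f l : has_sum f l -> has_sum (fun i => - f i) (- l).
Proof.
move=> fl; rewrite /has_sum.
under eq_fun do rewrite /partial_sum sumrN.
exact: (cvgN fl).
Qed.

Lemma has_sumB f g l m : has_sum f l -> has_sum g m ->
  has_sum (fun i => f i - g i) (l - m).
Proof. by move=> fl /has_sumN; apply: has_sumD. Qed.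

(** Finitely many eventual conditions hold simultaneously from some index on; the induction on [s]
    intersects them one by one. *)
Lemma near_mem_seq (s_ : nat -> seq I) (s : seq I) :
  (forall i, \forall n \near \oo, i \in s_ n) ->
  \forall n \near \oo, {subset s <= s_ n}.
Proof.
move=> hs; elim: s => [|i s IH]; first by near=> n.
near=> n => j; rewrite inE => /orP[/eqP ->|].
  by near: n; exact: hs.
by move: j; near: n.
Unshelve. all: by end_near. Qed.

Lemma cvg_totally (A_ : nat -> {fset I}) :
  (forall i, \forall n \near \oo, i \in A_ n) -> A_ @ \oo --> totally.
Proof.
move=> hA P [B _ BP].
have := near_mem_seq (fun n => A_ n : seq I) B hA.
apply: filterS => n h; apply: BP; apply/fsubsetP => i; exact: h.
Qed.

(** An exhausting sequence of finite sets converges to the filter [totally], so an unordered sum can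
    be evaluated along boxes or initial segments. *)
Lemma has_sum_seq f l (s_ : nat -> seq I) : (forall n, uniq (s_ n)) ->
  (forall i, \forall n \near \oo, i \in s_ n) -> has_sum f l ->
  \sum_(i <- s_ n) f i @[n --> \oo] --> l.
Proof.
move=> us hs fl; under eq_fun do rewrite -partial_sum_seq //.
apply: (cvg_comp (fun n => [fset x in s_ n]%fset) (partial_sum f) _ fl).
apply: cvg_totally => i; near=> n.
by rewrite in_fset; near: n.
Unshelve. all: by end_near. Qed.

End HasSum.

Lemma has_sum_reindex {I I' : choiceType} {K : numFieldType}
    {V : normedModType K} (f : I -> V) (l : V) (h : I' -> I) :
  injective h -> (forall i, f i != 0 -> exists j, i = h j) ->
  has_sum f l -> has_sum (f \o h) l.
Proof.
move=> hinj hsupp /has_sumP fl; apply/has_sumP => e e0.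
have [A0 A0P] := fl e e0.
(* Injectivity of [h] makes the preimage of the finite set [A0] finite; [s] lists it. *)
have [s sP] : exists s : seq I', forall j, h j \in (A0 : seq I) -> j \in s.
  elim: (A0 : seq I) => [|i t [s sP]]; first by exists [::].
  have [[j0 hj0]|nj] := pselect (exists j, h j = i).
    exists (j0 :: s) => j; rewrite !inE => /orP[/eqP|/sP ->]; last by rewrite orbT.
    by rewrite -hj0 => /hinj ->; rewrite eqxx.
  exists s => j; rewrite inE => /orP[/eqP hji|/sP //].
  by case: nj; exists j.
exists [fset j in s]%fset => B /fsubsetP sB.
(* Once [B] contains that preimage, an element of [A0] outside the image of [B] is not a value of
   [h] at all, so [f] vanishes there and enlarging by [A0] changes nothing. *)
pose A := ([fset h j | j in B] `|` A0)%fset.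
suff -> : partial_sum (f \o h) B = partial_sum f A by apply/A0P/fsubsetUr.
rewrite !partial_sumE /=.
rewrite [RHS](bigID (fun i => i \in [fset h j | j in B]%fset)) /=.
rewrite [X in _ + X]big1_seq ?addr0; last first.
  move=> i /andP[iB]; rewrite inE (negbTE iB) /= => iA0; apply/eqP/negPn/negP.
  move=> /hsupp[j ij]; move/negP: iB; apply; apply/imfsetP; exists j => //.
  by apply: sB; rewrite in_fset sP // -ij.
rewrite -[RHS]big_filter -(big_map h xpredT f).
apply: perm_big; apply: uniq_perm.
- by rewrite map_inj_uniq.
- by rewrite filter_uniq.
move=> i; rewrite mem_filter inE.
apply/mapP/idP => [[j jB ->]|/andP[/imfsetP[j jB ->] _]]; last by exists j.
by rewrite in_imfset.
Qed.

Definition bounded_sums {I : choiceType} {R : realType} (b : I -> R) :=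
  exists M, forall A : {fset I}, \sum_(i <- A) b i <= M.

Lemma sum_fset_in {I : choiceType} {V : nmodType} (f : I -> V)
    (A0 : {fset I}) (s : seq I) : uniq s -> {subset A0 <= s} ->
  \sum_(i <- s | i \in A0) f i = \sum_(i <- A0) f i.
Proof.
move=> us sA; rewrite -(big_filter _ (fun i => i \in A0)); apply: perm_big.
apply: uniq_perm; rewrite ?filter_uniq // => i.
by rewrite mem_filter; case: (boolP (i \in A0)) => //= /sA ->.
Qed.

(** * Absolute summability and dominated convergence *)

Section Summable.
Context {I : choiceType} {R : realType}.
Implicit Types (b : I -> R) (f : I -> R[i]).

(** For nonnegative terms the finite sums increase with the index set, so their supremum is the
    sum. *)
Lemma has_sum_ge0 b : (forall i, 0 <= b i) -> bounded_sums b ->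
  exists l : R, has_sum b l.
Proof.
move=> b0 [M bM]; pose S := [set partial_sum b A | A in [set: {fset I}]].
have hS : has_sup S.
  split; first by exists (partial_sum b fset0), fset0.
  by exists M => _ [A _ <-]; rewrite partial_sumE.
exists (reals.sup S); apply/has_sumP => e e0.
have [_ [A0 _ <-] A0P] := sup_adherent e0 hS.
exists A0 => A sA.
have le1 : partial_sum b A <= reals.sup S by apply: sup_upper_bound => //; exists A.
have le2 : partial_sum b A0 <= partial_sum b A.
  rewrite !partial_sumE -(sum_fset_in b A0 A) //; last exact/fsubsetP.
  by rewrite [leRHS](bigID (fun i => i \in A0)) /= lerDl sumr_ge0.
rewrite ger0_norm ?subr_ge0 //; lra.
Qed.

Lemma has_sum_tail b l : (forall i, 0 <= b i) -> has_sum b l ->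
  forall e : R, 0 < e -> exists A0 : {fset I}, forall A : {fset I},
    \sum_(i <- A | i \notin A0) b i < e.
Proof.
move=> b0 /has_sumP bl e e0.
have e20 : 0 < e / 2 by rewrite divr_gt0.
have [A0 A0P] := bl _ e20.
exists A0 => A.
have h1 := A0P _ (fsubset_refl A0).
have h2 := A0P _ (fsubsetUl A0 A).
have -> : \sum_(i <- A | i \notin A0) b i =
    partial_sum b (A0 `|` A)%fset - partial_sum b A0.
  rewrite !partial_sumE [in RHS](bigID (fun i => i \in A0)) /=.
  have -> : \sum_(i <- A | i \notin A0) b i =
      \sum_(i <- (A0 `|` A)%fset | i \notin A0) b i.
    rewrite -!(big_filter _ (fun i => i \notin A0)); apply: perm_big.
    apply: uniq_perm; rewrite ?filter_uniq // => i.
    by rewrite !mem_filter inE; case: (i \in A0).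
  rewrite sum_fset_in //; last exact/fsubsetP/fsubsetUl.
  by rewrite addrAC subrr add0r.
move: h1 h2; rewrite !ltr_norml => /andP[? ?] /andP[? ?]; lra.
Qed.

Lemma cvg_complex {T : Type} (F : set_system T) {FF : Filter F}
    (u v : T -> R) (a c : R) :
  u @ F --> a -> v @ F --> c ->
  (u x +i* v x : R[i]^o) @[x --> F] --> (a +i* c : R[i]^o).
Proof.
move=> ua vc; apply/cvgrPdist_lt => e; rewrite ltcE /= => /andP[/eqP e_im e0].
have e20 : 0 < complex.Re e / 2 by rewrite divr_gt0.
near=> x.
have -> : e = (complex.Re e)%:C by case: (e) e_im => ? ? /= ->.
have -> : (a +i* c : R[i]^o) - (u x +i* v x) =
  (a - u x)%:C + (c - v x)%:C * 'i%C by simpc.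
rewrite (le_lt_trans (ler_normD _ _)) // normrM.
rewrite !normc_def /= !expr0n /= !addr0 !add0r expr1n sqrtr1 mulr1.
rewrite !sqrtr_sqr -raddfD ltcR [ltRHS]splitr.
apply: ltrD; near: x; exact: cvgr_dist_lt.
Unshelve. all: by end_near. Qed.

(** The function [g + b] is nonnegative with finite sums at most twice those of [b]; subtracting the
    sum of [b] leaves that of [g]. *)
Lemma has_sum_real (g b : I -> R) : (forall i, `|g i| <= b i) ->
  bounded_sums b -> exists l : R, has_sum g l.
Proof.
move=> gb bM.
have b0 i : 0 <= b i by rewrite (le_trans _ (gb i)).
have [l bl] := has_sum_ge0 b b0 bM.
have [m gm] : exists m : R, has_sum (fun i => g i + b i) m.
  apply: has_sum_ge0.
    by move=> i; move: (gb i); rewrite ler_norml => /andP[? _]; lra.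
  case: bM => M bM; exists (M + M) => A; rewrite big_split lerD //.
  by rewrite (le_trans _ (bM A)) // ler_sum // => i _; rewrite (le_trans (ler_norm _)).
exists (m - l); have := has_sumB _ _ _ _ gm bl.
by under eq_fun do rewrite addrK.
Qed.

Lemma has_sum_complex f b : (forall i, `|f i| <= (b i)%:C) ->
  bounded_sums b -> exists l : R[i]^o, has_sum (f : I -> R[i]^o) l.
Proof.
move=> fb bM.
have [a fa] : exists a : R, has_sum (fun i => complex.Re (f i)) a.
  apply: has_sum_real bM => i.
  by rewrite -lecR (le_trans (normc_ge_Re _)).
have [c fc] : exists a : R, has_sum (fun i => complex.Im (f i)) a.
  apply: has_sum_real bM => i; rewrite -lecR (le_trans _ (fb i)) //.
  (* The imaginary part of z is, up to sign, the real part of iz, so the bound by the modulus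
     carries over. *)
  rewrite -normrN -ReiNIm (le_trans (normc_ge_Re _)) // normrM.
  by rewrite [X in _ * X]normc_def /= expr0n expr1n add0r sqrtr1 mulr1.
exists (a +i* c).
have E : partial_sum (f : I -> R[i]^o) = fun A =>
    partial_sum (fun i => complex.Re (f i)) A +i*
    partial_sum (fun i => complex.Im (f i)) A.
  apply: funext => A; rewrite /partial_sum.
  elim/big_rec3: _ => // i x y z _ ->.
  by case: (f _).
by rewrite /has_sum E; exact: cvg_complex.
Qed.

Lemma cvg_sum_seq {T : Type} {F : set_system T} {FF : Filter F}
    {K : numFieldType} {V : normedModType K}
    (g_ : T -> I -> V) (g : I -> V) (s : seq I) :
  (forall i, g_ t i @[t --> F] --> g i) ->
  \sum_(i <- s) g_ t i @[t --> F] --> \sum_(i <- s) g i.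
Proof.
move=> gg; elim: s => [|i s IH].
  by under eq_fun do rewrite big_nil; rewrite big_nil; exact: cvg_cst.
by under eq_fun do rewrite big_cons; rewrite big_cons; exact: (cvgD (gg i)).
Qed.

(** Dominated convergence for sums: a finite head [A0] converges termwise, and outside it the
    summable majorant [b] controls [f] and all [f_ n] uniformly. Terms and range may vary with [n]
    together. *)
Lemma tannery (f_ : nat -> I -> R[i]) f b (A_ : nat -> seq I) (l : R[i]^o) :
  (forall n i, `|f_ n i| <= (b i)%:C) -> bounded_sums b ->
  (forall i, (f_ n i : R[i]^o) @[n --> \oo] --> (f i : R[i]^o)) ->
  (forall n, uniq (A_ n)) -> (forall i, \forall n \near \oo, i \in A_ n) ->
  has_sum (f : I -> R[i]^o) l ->
  (\sum_(i <- A_ n) f_ n i : R[i]^o) @[n --> \oo] --> l.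
Proof.
move=> fb bM ff us hs fl.
have b0 i : 0 <= b i by rewrite -ler0c (le_trans _ (fb 0%N i)).
(* The majorant passes to the pointwise limit, up to an arbitrary d > 0. *)
have f_le i : `|f i| <= (b i)%:C.
  have rE : (complex.Re `|f i|)%:C = `|f i| by rewrite RRe_real.
  rewrite -rE lecR; apply/ler_addgt0Pr => d d0.
  have dC0 : 0 < d%:C by rewrite ltcR.
  have /filter_ex[n fn] : \forall n \near \oo, `|(f i : R[i]^o) - f_ n i| < d%:C.
    exact: cvgr_dist_lt (ff i) _ dC0.
  rewrite -lecR rE raddfD /= -(subrK (f_ n i) (f i)) addrC.
  by rewrite (le_trans (ler_normD _ _)) // lerD // ltW.
have [m bm] := has_sum_ge0 b b0 bM.
apply/cvgrPdist_lt => e e0.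
have e30 : 0 < e / 3 by rewrite divr_gt0.
have ere : ((complex.Re (e / 3))%:C = e / 3) by rewrite RRe_real // gtr0_real.
(* A positive element of [R[i]] is real, so the real tail estimate applies; the further half is
   there because |f - f_n| is bounded by 2b. *)
have er0 : 0 < complex.Re (e / 3) / 2.
  by rewrite divr_gt0 // -ltcR ere.
have [A0 A0P] := has_sum_tail b m b0 bm _ er0.
have h1 : \forall n \near \oo, `|l - \sum_(i <- A_ n) f i| < e / 3.
  exact: cvgr_dist_lt (has_sum_seq _ _ _ us hs fl) _ e30.
have h2 : \forall n \near \oo,
    `|(\sum_(i <- A0) f i : R[i]^o) - \sum_(i <- A0) f_ n i| < e / 3.
  exact: cvgr_dist_lt (cvg_sum_seq _ _ A0 ff) _ e30.
near=> n.
have -> : e = e / 3 + (e / 3 + e / 3) by field.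
(* Three errors, each below e / 3: truncating the limit sum to [A_ n], termwise convergence on [A0],
   and the tail outside [A0]. *)
have -> : l - \sum_(i <- A_ n) f_ n i =
    (l - \sum_(i <- A_ n) f i) +
    ((\sum_(i <- A0) f i - \sum_(i <- A0) f_ n i) +
      \sum_(i <- A_ n | i \notin A0) (f i - f_ n i)).
  have sA : {subset A0 <= A_ n}.
    by move=> i; move: i; near: n; exact: (near_mem_seq A_ A0 hs).
  rewrite -!(sum_fset_in _ A0 (A_ n)) // -sumrB.
  have <- := @bigID _ _ _ _ (A_ n) (mem A0) xpredT (fun i => f i - f_ n i).
  by rewrite sumrB addrA subrK.
rewrite (le_lt_trans (ler_normD _ _)) // ltrD //.
  by near: n.
rewrite (le_lt_trans (ler_normD _ _)) // ltrD //.
  by near: n.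
rewrite (le_lt_trans (ler_norm_sum _ _ _)) //.
rewrite (@le_lt_trans _ _ (\sum_(i <- A_ n | i \notin A0) (b i)%:C +
  \sum_(i <- A_ n | i \notin A0) (b i)%:C)) //.
  rewrite -big_split ler_sum // => i _.
  by rewrite (le_trans (ler_normB _ _)) // lerD.
rewrite -raddf_sum -raddfD -ere ltcR [ltRHS]splitr.
have hA : \sum_(i <- A_ n | i \notin A0) b i < complex.Re (e / 3) / 2.
  have := A0P [fset i in A_ n]%fset.
  congr (_ < _); rewrite -(big_filter _ (fun i => i \notin A0)).
  rewrite -[RHS](big_filter _ (fun i => i \notin A0)).
  apply: perm_big; apply: uniq_perm; rewrite ?filter_uniq // => i.
  by rewrite !mem_filter in_fset.
exact: ltrD.
Unshelve. all: by end_near. Qed.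

End Summable.

(** * Finite Rogers-Ramanujan identities *)

Definition tri (r : int) : int := ((r * (r - 1)) %/ 2)%Z.

Lemma tri2 (r : int) : tri r * 2 = r * (r - 1).
Proof.
have [h|h] : (2 %| r)%Z \/ (2 %| r - 1)%Z by lia.
  by rewrite /tri divzK // dvdz_mulr.
by rewrite /tri divzK // dvdz_mull.
Qed.

Lemma tri0 : tri 0 = 0.
Proof. by rewrite /tri mul0r div0z. Qed.

Lemma tri1 : tri 1 = 0.
Proof. by rewrite /tri subrr mulr0 div0z. Qed.

Lemma triD (r s : int) : tri (r + s) = tri r + tri s + r * s.
Proof.
have := tri2 r; have := tri2 s; have := tri2 (r + s) => h1 h2 h3.
apply: (@mulIf _ (2 : int)) => //; rewrite !mulrDl h1 h2 h3; ring.
Qed.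

Definition qfact {F : fieldType} (q : F) (n : nat) : F :=
  \prod_(0 <= i < n) (1 - q ^+ i.+1).

(* The convention 1 / (q; q)_m = 0 for m < 0 makes all sums below bilateral. *)
Definition iqfact {F : fieldType} (q : F) (m : int) : F :=
  if m is Posz n then (qfact q n)^-1 else 0.

Arguments iqfact : simpl never.

(** The half-open interval -N <= r < N. Its asymmetry is harmless, since the boxes exhaust the
    integers. *)
Definition boxZ (N : nat) : seq int := [seq k%:Z - N%:Z | k <- iota 0 (N + N)].

Lemma big_boxZ {V : nmodType} (f : int -> V) (N : nat) :
  \sum_(r <- boxZ N) f r = \sum_(0 <= k < N + N) f (k%:Z - N%:Z).
Proof. by rewrite /boxZ big_map /index_iota subn0. Qed.

Lemma big_boxZ_shift {V : nmodType} (f : int -> V) (N m L : nat) :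
  (m <= N)%N -> (L <= N + m)%N ->
  (forall r, r < - m%:Z -> f r = 0) -> (forall r, L%:Z - m%:Z <= r -> f r = 0) ->
  \sum_(r <- boxZ N) f r = \sum_(0 <= k < L) f (k%:Z - m%:Z).
Proof.
move=> mN LN f_lo f_hi; rewrite big_boxZ.
rewrite (big_cat_nat (n := (N - m)%N)) //=; last by lia.
rewrite big_nat_cond big1 ?add0r; last first.
  by move=> k /andP[/andP[_ kn] _]; apply: f_lo; lia.
rewrite (big_cat_nat (n := (N - m + L)%N)) //=; [|lia|lia].
rewrite [X in _ + X]big_nat_cond [X in _ + X]big1 ?addr0; last first.
  by move=> k /andP[/andP[kn _] _]; apply: f_hi; lia.
rewrite -{1}[(N - m)%N]add0n big_addn (_ : (N - m + L) - (N - m) = L)%N; last by lia.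
by apply: eq_big_nat => k _; congr f; lia.
Qed.

(* Bailey's lemma relative to a = q^e, applied s times to the unit Bailey pair. *)
Definition alpha {F : fieldType} (q : F) (e : nat) (s : nat) (r : int) : F :=
  (-1) ^ r * q ^ (tri r + s%:Z * (r * (r + e%:Z))).

(** The beta side of the Bailey pair. Terms vanish unless -n - e <= r <= n, so the value is the same
    for all N > n + e. *)
Definition bailey_sum {F : fieldType} (q : F) (e s n N : nat) : F :=
  \sum_(r <- boxZ N)
    alpha q e s r * iqfact q (n%:Z - r) * iqfact q (n%:Z + r + e%:Z).

Section QIdentities.
Context {F : fieldType} (q : F).
Local Notation iq := (iqfact q).

Lemma iqfact0 : iq 0 = 1.
Proof. by rewrite -[0]/(Posz 0) /iqfact /qfact big_geq ?invr1. Qed.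

Lemma iqfact_neg (m : int) : m < 0 -> iq m = 0.
Proof. by case: m. Qed.

Context (q_nonroot : forall n, 1 - q ^+ n.+1 != 0).

Lemma qfact_neq0 n : qfact q n != 0.
Proof. by rewrite prodf_seq_neq0; apply/allP => i _; rewrite q_nonroot. Qed.

(** The zero convention makes the recurrence valid for every integer: at m = 0 the factor 1 - q^0
    vanishes. *)
Lemma iqfact_pred (m : int) : iq (m - 1) = (1 - q ^ m) * iq m.
Proof.
case: m => [[|n]|n].
- by rewrite expr0z subrr mul0r.
- have -> : n.+1%:Z - 1 = n by lia.
  rewrite /iqfact /qfact big_nat_recr //= invfM mulrCA mulfV ?mulr1 //.
  exact: q_nonroot.
by rewrite (iqfact_neg (Negz n)) // mulr0 iqfact_neg //; lia.
Qed.

Context (q_neq0 : q != 0).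

(** The q-Chu-Vandermonde sum. Induction on M: after multiplication by 1 - q^(M+1) = (1 - q^(M+1-j))
    + q^(M+1-j) (1 - q^j), the first part is the sum for (M, c), and the second, after j becomes j +
    1, is q^(M+1+c) times the sum for (M, c + 1). *)
Lemma qvandermonde (M : nat) (c : int) :
  \sum_(0 <= j < M.+1) q ^ (j%:Z * (j%:Z + c)) * iq (M%:Z - j%:Z) * iq j%:Z *
     iq (j%:Z + c) = iq M%:Z * iq (M%:Z + c).
Proof.
elim: M c => [|M IH] c.
  by rewrite big_nat1 mul0r expr0z subr0 mul1r iqfact0 !mul1r.
apply: (mulfI (q_nonroot M)); rewrite mulrA.
rewrite -[RHS]/((1 - q ^ M.+1%:Z) * iq M.+1%:Z * iq (M.+1%:Z + c)).
rewrite -iqfact_pred (_ : M.+1%:Z - 1 = M); last by lia.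
have -> : iq M * iq (M.+1%:Z + c) =
    iq M * iq (M%:Z + c) + q ^ (M.+1%:Z + c) * (iq M * iq (M%:Z + (c + 1))).
  have -> : M%:Z + c = M.+1%:Z + c - 1 by lia.
  have -> : M%:Z + (c + 1) = M.+1%:Z + c by lia.
  rewrite iqfact_pred; ring.
rewrite -!IH !mulr_sumr.
transitivity (\sum_(0 <= j < M.+2)
   (q ^ (j%:Z * (j%:Z + c)) * iq (M%:Z - j%:Z) * iq j%:Z * iq (j%:Z + c) +
    q ^ (j%:Z * (j%:Z + c) + (M.+1%:Z - j%:Z)) * iq (M.+1%:Z - j%:Z) *
      iq (j%:Z - 1) * iq (j%:Z + c))).
  apply: eq_big_nat => j /andP[_ jM].
  have -> : M%:Z - j%:Z = M.+1%:Z - j%:Z - 1 by lia.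
  rewrite !iqfact_pred [q ^ (_ * _ + _)]expfzDr // -[q ^+ M.+1]/(q ^ M.+1%:Z).
  have -> : q ^ M.+1%:Z = q ^ (M.+1%:Z - j%:Z) * q ^ j%:Z.
    by rewrite -expfzDr // subrK.
  ring.
rewrite big_split /=; congr (_ + _).
  rewrite big_nat_recr //= (iqfact_neg (M%:Z - M.+1%:Z)); last by lia.
  by rewrite mulr0 !mul0r addr0.
rewrite big_nat_recl // (iqfact_neg (0%N%:Z - 1)) // mulr0 mul0r add0r.
apply: eq_big_nat => j _; rewrite !mulrA -expfzDr //.
congr (q ^ _ * iq _ * iq _ * iq _); lia.
Qed.

(** Bailey's lemma for a single index r. For r = m >= 0 the shift k = j + m turns it into
    [qvandermonde] with c = 2m + e, since (j + m)(j + m + e) = m (m + e) + j (j + 2m + e). *)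
Lemma bailey_step (e n : nat) (r : int) : (e <= 1)%N ->
  \sum_(0 <= k < n.+1) q ^ (k%:Z * (k%:Z + e%:Z)) * iq (n%:Z - k%:Z) *
     (iq (k%:Z - r) * iq (k%:Z + r + e%:Z)) =
  q ^ (r * (r + e%:Z)) * (iq (n%:Z - r) * iq (n%:Z + r + e%:Z)).
Proof.
move=> e1.
(* The reflection of r to - r - e swaps the two inverse factorials and fixes r (r + e); as e <= 1,
   it sends negative r to nonnegative ones. *)
wlog [m ->] : r / exists m : nat, r = m.
  move=> wl; have [r0|r0] := leP 0 r; first by apply: wl; exists `|r|%N; lia.
  have /wl h : exists m : nat, - r - e%:Z = m by exists `|- r - e%:Z|%N; lia.
  transitivity (q ^ ((- r - e%:Z) * (- r - e%:Z + e%:Z)) *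
      (iq (n%:Z - (- r - e%:Z)) * iq (n%:Z + (- r - e%:Z) + e%:Z))).
    rewrite -h; apply: eq_bigr => k _; congr (_ * _); rewrite mulrC.
    by congr (iq _ * iq _); lia.
  rewrite [iq _ * iq _]mulrC; congr (q ^ _ * (iq _ * iq _)); lia.
have [nm|mn] := ltnP n m.
  rewrite (iqfact_neg (n%:Z - m%:Z)) ?mul0r ?mulr0; last by lia.
  rewrite big_nat_cond big1 // => k /andP[/andP[_ kn] _].
  by rewrite (iqfact_neg (k%:Z - m%:Z)) ?mul0r ?mulr0 //; lia.
have [M ->] : exists M, n = (M + m)%N by exists (n - m)%N; lia.
have -> : (M + m)%N%:Z - m%:Z = M by lia.
have -> : (M + m)%N%:Z + m%:Z + e%:Z = M%:Z + (m + m + e)%N%:Z by lia.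
rewrite -qvandermonde mulr_sumr (big_cat_nat (n := m)) //=; last by lia.
rewrite big_nat_cond big1 ?add0r; last first.
  move=> k /andP[/andP[_ kn] _].
  by rewrite (iqfact_neg (k%:Z - m%:Z)) ?mul0r ?mulr0 //; lia.
rewrite -{1}[m]add0n big_addn (_ : (M + m).+1 - m = M.+1)%N; last by lia.
apply: eq_big_nat => j _.
rewrite -[X in _ = _ * X]mulrA -[X in _ = _ * X]mulrA [RHS]mulrA -expfzDr // [RHS]mulrA.
by congr (q ^ _ * iq _ * (iq _ * iq _)); lia.
Qed.

(** The finite q-binomial theorem divided by (q)_M. Here 1 - q^(M+1) = q^k (1 - q^(M+1-k)) + (1 -
    q^k) splits the sum into the case (M, zq) and -z times it, which peels off the factor 1 - z. *)
Lemma qbinomial (M : nat) (z : F) :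
  \sum_(0 <= k < M.+1) (-1) ^+ k * q ^ tri k%:Z * z ^+ k * (iq k%:Z * iq (M%:Z - k%:Z)) =
  iq M * \prod_(0 <= i < M) (1 - z * q ^+ i).
Proof.
elim: M z => [|M IH] z.
  by rewrite big_nat1 big_geq // tri0 expr0z !expr0 !mulr1 subr0 iqfact0 !mulr1.
apply: (mulfI (q_nonroot M)); rewrite mulrA.
rewrite -[RHS]/((1 - q ^ M.+1%:Z) * iq M.+1%:Z * _).
rewrite -iqfact_pred (_ : M.+1%:Z - 1 = M); last by lia.
transitivity ((1 - z) * (iq M * \prod_(0 <= i < M) (1 - (z * q) * q ^+ i))); last first.
  rewrite mulrCA big_nat_recl // expr0 mulr1; do 2!congr (_ * _).
  by apply: eq_bigr => i _; rewrite exprS mulrA.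
rewrite -IH [RHS]mulrBl mul1r [LHS]mulr_sumr.
transitivity (\sum_(0 <= k < M.+2)
   ((-1) ^+ k * q ^ tri k%:Z * (z * q) ^+ k * (iq k%:Z * iq (M%:Z - k%:Z)) +
   (-1) ^+ k * q ^ tri k%:Z * z ^+ k * (iq (k%:Z - 1) * iq (M.+1%:Z - k%:Z)))).
  apply: eq_big_nat => j /andP[_ jM].
  have -> : M%:Z - j%:Z = M.+1%:Z - j%:Z - 1 by lia.
  rewrite !iqfact_pred -[q ^+ M.+1]/(q ^ M.+1%:Z).
  have -> : q ^ M.+1%:Z = q ^ (M.+1%:Z - j%:Z) * q ^ j%:Z.
    by rewrite -expfzDr // subrK.
  rewrite exprMn -[q ^+ j]/(q ^ j%:Z); ring.
rewrite big_split /=; congr (_ + _).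
  rewrite big_nat_recr //= (iqfact_neg (M%:Z - M.+1%:Z)); last by lia.
  by rewrite !mulr0 addr0.
rewrite big_nat_recl // (iqfact_neg (0%N%:Z - 1)) // mul0r mulr0 add0r.
rewrite mulr_sumr -sumrN; apply: eq_big_nat => j _.
have -> : j.+1%:Z - 1 = j by lia.
have -> : M.+1%:Z - j.+1%:Z = M%:Z - j%:Z by lia.
have -> : tri j.+1%:Z = tri j%:Z + j%:Z.
  by rewrite -addn1 PoszD triD mulr1 tri1 addr0.
rewrite expfzDr // exprMn !exprS -[q ^+ j]/(q ^ j%:Z); ring.
Qed.

Lemma bailey_sumS (e s n N : nat) : (e <= 1)%N ->
  bailey_sum q e s.+1 n N =
  \sum_(0 <= k < n.+1) q ^ (k%:Z * (k%:Z + e%:Z)) * iq (n%:Z - k%:Z) *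
    bailey_sum q e s k N.
Proof.
move=> e1; rewrite /bailey_sum.
under [RHS]eq_bigr do rewrite mulr_sumr.
rewrite exchange_big /=; apply: eq_bigr => r _.
transitivity (alpha q e s r * (\sum_(0 <= k < n.+1)
   q ^ (k%:Z * (k%:Z + e%:Z)) * iq (n%:Z - k%:Z) *
     (iq (k%:Z - r) * iq (k%:Z + r + e%:Z)))).
  rewrite bailey_step // [RHS]mulrA -mulrA; congr (_ * _).
  rewrite /alpha -mulrA -expfzDr //; congr (_ * q ^ _).
  by rewrite intS mulrDl mul1r addrCA addrC [tri r + _]addrC.
rewrite mulr_sumr; apply: eq_bigr => k _.
rewrite mulrCA -!mulrA; congr (_ * (_ * _)).
Qed.

(** The unit Bailey pair. With r = k - (n + e) the sum is [qbinomial] for 2n + e and z = q^(-(n +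
    e)); for n > 0 the product contains the zero factor i = n + e. *)
Lemma bailey_sum0 (e n N : nat) : (e <= 1)%N -> (n + e < N)%N ->
  bailey_sum q e 0 n N = (n == 0%N)%:R.
Proof.
move=> e1 nN; rewrite /bailey_sum.
rewrite (@big_boxZ_shift _ _ N (n + e) (n + n + e).+1); first last.
- by move=> r hr; rewrite (iqfact_neg (n%:Z - r)) ?mulr0 ?mul0r //; lia.
- by move=> r hr; rewrite (iqfact_neg (n%:Z + r + e%:Z)) ?mulr0 //; lia.
- lia.
- lia.
pose m := (n + e)%N%:Z.
transitivity ((-1) ^ (- m) * q ^ tri (- m) *
   (iq (n + n + e)%N * \prod_(0 <= i < n + n + e) (1 - q ^ (- m) * q ^+ i))).
  rewrite -qbinomial mulr_sumr; apply: eq_big_nat => k /andP[_ kM].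
  rewrite /alpha mul0r addr0 -mulrA.
  have -> : n%:Z - (k%:Z - m) = (n + n + e)%N%:Z - k%:Z by rewrite /m; lia.
  have -> : n%:Z + (k%:Z - m) + e%:Z = k%:Z by rewrite /m; lia.
  rewrite triD !expfzDr ?oppr_eq0 ?oner_eq0 //.
  have -> : q ^ (k%:Z * - m) = (q ^ (- m)) ^+ k.
    by rewrite mulrC -[RHS]/((q ^ (- m)) ^ k%:Z) exprz_exp.
  rewrite -[(-1) ^+ k]/((-1) ^ k%:Z).
  rewrite [iq (_ - _) * _]mulrC; set u := iq _ * iq _.
  by move: u (_ ^ k%:Z) (_ ^ (- m)) => u x y; ring.
have [n0|n0] := eqVneq n 0%N; last first.
  rewrite (big_cat_nat (n := (n + e)%N)) //=; last by lia.
  rewrite [X in _ * (_ * (_ * X))]big_ltn; last by lia.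
  rewrite -[q ^+ (n + e)]/(q ^ (n + e)%N%:Z) -expfzDr // addNr expr0z subrr.
  by rewrite mul0r !mulr0.
(* For n = 0 the product has e factors: it is empty for e = 0, and for e = 1 the factor 1 - 1/q
   cancels against -q / (1 - q). *)
rewrite /m n0; case: e e1 {nN m} => [|[|//]] _.
  rewrite !addn0 (_ : - 0%N%:Z = 0) // tri0 !expr0z iqfact0 big_geq //.
  by rewrite !mulr1.
have -> : tri (- (0 + 1)%N%:Z) = 1.
  by apply: (@mulIf _ (2 : int)) => //; rewrite tri2; lia.
rewrite big_nat1 expr0 mulr1 /iqfact /qfact big_nat1 expr1z.
have expN1 (x : F) : x ^ (- (0 + 1)%N%:Z) = x^-1 by [].
have := q_nonroot 0; rewrite expr1 => q1.
by rewrite !expN1 invrN1 mulr1n; field; rewrite q_neq0 q1.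
Qed.

Lemma bailey_sum1 (e n N : nat) : (e <= 1)%N -> (n + e < N)%N ->
  bailey_sum q e 1 n N = iq n.
Proof.
move=> e1 nN; rewrite bailey_sumS // big_nat_recl //.
rewrite bailey_sum0 //; last by lia.
rewrite mul0r expr0z subr0 mul1r mulr1 big_nat_cond big1 ?addr0 //.
move=> k /andP[/andP[_ kn] _]; rewrite bailey_sum0 ?mulr0 //; lia.
Qed.

(** The second Bailey step, with the first one already collapsed to 1 / (q)_k. Letting n grow gives
    the Rogers-Ramanujan identities. *)
Lemma finite_rogers_ramanujan (e n N : nat) : (e <= 1)%N -> (n + e < N)%N ->
  bailey_sum q e 2 n N =
  \sum_(0 <= k < n.+1) q ^ (k%:Z * (k%:Z + e%:Z)) * iq (n%:Z - k%:Z) * iq k.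
Proof.
move=> e1 nN; rewrite bailey_sumS //; apply: eq_big_nat => k kn.
by rewrite bailey_sum1 //; lia.
Qed.

End QIdentities.

(** * Rogers-Ramanujan identities *)

Lemma boxZ_uniq N : uniq (boxZ N).
Proof. by rewrite map_inj_uniq ?iota_uniq // => i j; lia. Qed.

Lemma mem_boxZ N r : (r \in boxZ N) = (- N%:Z <= r < N%:Z).
Proof.
apply/mapP/idP => [[k]|rN]; first by rewrite mem_iota; lia.
by exists (absz (r + N%:Z)); rewrite ?mem_iota; lia.
Qed.

Lemma boxZ_cofinal r (h : nat -> nat) : (forall n, n <= h n)%N ->
  \forall n \near \oo, r \in boxZ (h n).
Proof.
move=> nh; exists `|r|.+1%N => // n /= rn; rewrite mem_boxZ.
by have := nh n; lia.
Qed.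

Definition boxZ2 N : seq (int * int) := [seq (x, y) | x <- boxZ N, y <- boxZ N].

Lemma boxZ2_uniq N : uniq (boxZ2 N).
Proof. by apply: allpairs_uniq; rewrite ?boxZ_uniq // => -[? ?] [? ?] _ _. Qed.

Lemma boxZ2_cofinal w : \forall n \near \oo, w \in boxZ2 n.
Proof.
case: w => x y; near=> n; apply: allpairs_f; near: n.
  exact: (@boxZ_cofinal _ id).
exact: (@boxZ_cofinal _ id).
Unshelve. all: by end_near. Qed.

Lemma sum_boxZ2 {K : pzRingType} (f g : int -> K) N :
  \sum_(w <- boxZ2 N) f w.1 * g w.2 =
  (\sum_(r <- boxZ N) f r) * (\sum_(r <- boxZ N) g r).
Proof.
rewrite big_allpairs_dep mulr_suml; apply: eq_bigr => i _ /=.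
by rewrite mulr_sumr.
Qed.

(** * Geometric majorants *)

Section Geometric.
Context {R : realType}.

(** Every finite set lies in some [s_ n], so for nonnegative terms a bound along the exhausting
    sequence suffices. *)
Lemma bounded_sums_seq {I : choiceType} (b : I -> R) (s_ : nat -> seq I) (M : R) :
  (forall i, 0 <= b i) -> (forall n, uniq (s_ n)) ->
  (forall i, \forall n \near \oo, i \in s_ n) ->
  (forall n, \sum_(i <- s_ n) b i <= M) -> bounded_sums b.
Proof.
move=> b0 us hs sM; exists M => A.
have /filter_ex[n sA] := near_mem_seq s_ A hs.
rewrite (le_trans _ (sM n)) // [leRHS](bigID (fun i => i \in A)) /=.
by rewrite sum_fset_in // lerDl sumr_ge0.
Qed.

Lemma bounded_sumsZ {I : choiceType} (c : R) (b : I -> R) : 0 <= c ->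
  bounded_sums b -> bounded_sums (fun i => c * b i).
Proof.
move=> c0 [M bM]; exists (c * M) => A.
by rewrite -mulr_sumr ler_wpM2l.
Qed.

Context (rho : R) (rho_ge0 : 0 <= rho) (rho_lt1 : rho < 1).

Lemma geometric_le n : \sum_(0 <= k < n) rho ^+ k <= (1 - rho)^-1.
Proof.
have r1 : 0 < 1 - rho by rewrite subr_gt0.
suff -> : \sum_(0 <= k < n) rho ^+ k = (1 - rho ^+ n) / (1 - rho).
  by rewrite ler_pdivrMr // mulVf ?gt_eqF // gerBl exprn_ge0.
apply: (canRL (mulfK _)); first by rewrite gt_eqF.
elim: n => [|n IH]; first by rewrite big_geq // mul0r subrr.
by rewrite big_nat_recr //= mulrDl IH exprS; ring.
Qed.

Lemma bounded_sums_nat : bounded_sums (fun k : nat => rho ^+ k).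
Proof.
apply: (bounded_sums_seq _ (fun n => iota 0 n) (1 - rho)^-1).
- by move=> i; rewrite exprn_ge0.
- by move=> n; rewrite iota_uniq.
- by move=> i; exists i.+1 => // n /= ?; rewrite mem_iota.
by move=> n; have := geometric_le n; rewrite /index_iota subn0.
Qed.

Lemma sum_boxZ_le N : \sum_(r <- boxZ N) rho ^+ `|r| <= 2 * (1 - rho)^-1.
Proof.
apply: (@le_trans _ _ (2 * \sum_(0 <= k < N.+1) rho ^+ k)); last first.
  by rewrite ler_wpM2l // geometric_le.
rewrite big_boxZ mulrC mulr_natr mulr2n (big_cat_nat (n := N)) //=; last by lia.
rewrite lerD //.
  rewrite big_nat_rev /= add0n [leRHS]big_nat_recl //= ler_wpDl //.
  rewrite [leLHS]big_nat_cond [leRHS]big_nat_cond ler_sum // => k /andP[kN _].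
  by rewrite (_ : `|_|%N = k.+1) //; lia.
rewrite -{1}[N]add0n big_addn addnK [leRHS]big_nat_recr //= ler_wpDr ?exprn_ge0 //.
rewrite [leLHS]big_nat_cond [leRHS]big_nat_cond ler_sum // => k /andP[kN _].
by rewrite (_ : `|_|%N = k) //; lia.
Qed.

Lemma bounded_sums_int : bounded_sums (fun r : int => rho ^+ `|r|).
Proof.
apply: (bounded_sums_seq _ boxZ (2 * (1 - rho)^-1)).
- by move=> i; rewrite exprn_ge0.
- exact: boxZ_uniq.
- by move=> r; exact: (@boxZ_cofinal _ id).
exact: sum_boxZ_le.
Qed.

Lemma bounded_sums_int2 :
  bounded_sums (fun w : int * int => rho ^+ (`|w.1| + `|w.2|)).
Proof.
apply: (bounded_sums_seq _ boxZ2 ((2 * (1 - rho)^-1) * (2 * (1 - rho)^-1))).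
- by move=> i; rewrite exprn_ge0.
- exact: boxZ2_uniq.
- exact: boxZ2_cofinal.
move=> N; under eq_bigr do rewrite exprD.
rewrite (sum_boxZ2 (fun r => rho ^+ `|r|) (fun r => rho ^+ `|r|)).
by rewrite ler_pM ?sum_boxZ_le // sumr_ge0 // => i _; rewrite exprn_ge0.
Qed.

(** The increments are absolutely summable, and [u] is recovered from them by telescoping. *)
Lemma cvg_geometric_steps (u : nat -> R[i]) (M : R) :
  (forall n, `|u n.+1 - u n| <= (M * rho ^+ n)%:C) ->
  exists l : R[i]^o, (u n : R[i]^o) @[n --> \oo] --> l.
Proof.
move=> hu.
have M0 : 0 <= M.
  by have := le_trans (normr_ge0 _) (hu 0%N); rewrite expr0 mulr1 ler0c.
have [l hl] := has_sum_complex _ _ hu (bounded_sumsZ _ _ M0 bounded_sums_nat).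
have uE : (fun n => u 0%N + \sum_(k <- iota 0 n) (u k.+1 - u k)) = u.
  apply: funext => n; have := telescope_sumr u (leq0n n).
  by rewrite /index_iota subn0 => ->; rewrite addrC subrK.
have h : (\sum_(k <- iota 0 n) (u k.+1 - u k) : R[i]^o) @[n --> \oo] --> l.
  apply: (has_sum_seq _ _ _ _ _ hl) => [n|i]; first by rewrite iota_uniq.
  by exists i.+1 => // n /= ?; rewrite mem_iota.
exists (u 0%N + l).
suff : (u 0%N + \sum_(k <- iota 0 n) (u k.+1 - u k) : R[i]^o) @[n --> \oo]
  --> (u 0%N + l : R[i]^o) by rewrite [X in fmap X]uE.
exact: (cvgD (cvg_cst (u 0%N : R[i]^o)) h).
Qed.

End Geometric.

(** * Infinite products and the limit of the finite identities *)

Section RogersRamanujan.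
Context {R : realType} (q : R[i]) (q_neq0 : q != 0) (q_lt1 : `|q| < 1).
Local Notation rho := (complex.Re `|q|).
Local Notation iq := (iqfact q).

Lemma normq : `|q| = rho%:C.
Proof. by rewrite RRe_real. Qed.

Lemma rho_gt0 : 0 < rho.
Proof. by rewrite -ltcR -normq normr_gt0. Qed.

Lemma rho_lt1 : rho < 1.
Proof. by rewrite -ltcR -normq. Qed.

Lemma norm_qX n : `|q ^+ n| = (rho ^+ n)%:C.
Proof. by rewrite normrX normq rmorphXn. Qed.

Lemma q_nonroot n : 1 - q ^+ n.+1 != 0.
Proof.
rewrite subr_eq0; apply/eqP => /(congr1 Num.norm); rewrite normr1 norm_qX => /esym.
move=> /(congr1 (@complex.Re R)) /= /eqP; apply/negP.
by rewrite lt_eqF // exprn_ilt1 // ?(ltW rho_gt0) // rho_lt1.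
Qed.

Lemma prod_le_expR (x : nat -> R) n : (forall i, 0 <= 1 + x i) ->
  \prod_(0 <= i < n) (1 + x i) <= expR (\sum_(0 <= i < n) x i).
Proof.
move=> x0; elim: n => [|n IH]; first by rewrite !big_geq // expR0.
rewrite !big_nat_recr //= expRD ler_pM ?expR_ge1Dx //.
by rewrite prodr_ge0.
Qed.

Lemma qfact_bounded : exists M : R, forall n, `|qfact q n| <= M%:C.
Proof.
exists (expR (1 - rho)^-1) => n.
rewrite /qfact normr_prod.
apply: (@le_trans _ _ ((\prod_(0 <= i < n) (1 + rho ^+ i))%:C)).
  rewrite rmorph_prod ler_prod // => i _; rewrite normr_ge0 /=.
  rewrite (le_trans (ler_normB _ _)) // normr1 norm_qX rmorphD lerD2l lecR.
  by rewrite exprS ler_piMl ?exprn_ge0 ?(ltW rho_gt0) // (ltW rho_lt1).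
rewrite lecR (le_trans (prod_le_expR _ _ _)) //.
  by move=> i; rewrite addr_ge0 // exprn_ge0 // ltW // rho_gt0.
by rewrite ler_expR geometric_le ?rho_lt1 // ltW // rho_gt0.
Qed.

(** Each factor satisfies 1 / |1 - q^(i+1)| <= 1 + rho^i / (1 - rho), and 1 + x <= exp x bounds the
    product. Uniformity in m supplies the majorants for [tannery]. *)
Lemma iqfact_bounded : exists M : R, forall m, `|iq m| <= M%:C.
Proof.
have r0 := rho_gt0; have r1 := rho_lt1.
exists (expR ((1 - rho)^-1 * (1 - rho)^-1)) => -[n|n]; last first.
  by rewrite iqfact_neg // normr0 ler0c expR_ge0.
rewrite /iqfact /qfact normfV normr_prod.
have hi i : 0 < 1 - rho ^+ i.+1 by rewrite subr_gt0 exprn_ilt1 // ltW.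
apply: (@le_trans _ _ ((\prod_(0 <= i < n) (1 + (1 - rho)^-1 * rho ^+ i))%:C)).
  rewrite rmorph_prod -prodfV ler_prod // => i _; rewrite invr_ge0 normr_ge0 /=.
  apply: (@le_trans _ _ (1 - rho ^+ i.+1)^-1%:C).
    rewrite fmorphV lef_pV2 ?posrE ?normr_gt0 ?q_nonroot ?ltcR ?hi //.
    rewrite rmorphB /= -norm_qX -[X in X - _](@normr1 R[i]).
    exact: lerB_dist.
  rewrite lecR -[leLHS]mul1r ler_pdivrMr // exprS.
  have y0 : 0 <= rho ^+ i by rewrite exprn_ge0 // ltW.
  have y1 : rho ^+ i <= 1 by rewrite exprn_ile1 // ltW.
  have c0 : 0 <= (1 - rho)^-1 by rewrite invr_ge0 subr_ge0 ltW.
  have : (1 - rho)^-1 * (1 - rho) = 1 by rewrite mulVf // gt_eqF // subr_gt0.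
  move: (rho ^+ i) (1 - rho)^-1 y0 y1 c0 => y c y0 y1 c0 cE.
  (* With y = rho^i and c = 1 / (1 - rho), (1 + c y)(1 - rho y) - 1 = y (1 - rho) + c rho y (1 - y),
     a sum of two nonnegative terms. *)
  have cyE : c * y = y + c * rho * y by rewrite -{2}[y]mul1r -cE; ring.
  have := mulr_ge0 (mulr_ge0 c0 (ltW r0)) (mulr_ge0 y0 (_ : 0 <= 1 - y)).
  rewrite subr_ge0 => /(_ y1); have := mulr_ge0 y0 (_ : 0 <= 1 - rho).
  rewrite subr_ge0 => /(_ (ltW r1)); nra.
rewrite lecR (le_trans (prod_le_expR _ _ _)) //.
  by move=> i; rewrite addr_ge0 // mulr_ge0 ?exprn_ge0 ?invr_ge0 ?subr_ge0 // ltW.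
rewrite ler_expR -mulr_sumr ler_wpM2l ?invr_ge0 ?subr_ge0 ?(ltW r1) //.
by rewrite geometric_le // ltW.
Qed.

(** Both (q)_n and 1 / (q)_n have geometrically small increments, hence limits; the product of the
    limits is 1, so neither is zero. *)
Lemma qfact_cvg : exists J1 : R[i], [/\ J1 != 0,
  (qfact q n : R[i]^o) @[n --> \oo] --> (J1 : R[i]^o) &
  (iq n%:Z : R[i]^o) @[n --> \oo] --> (J1^-1 : R[i]^o)].
Proof.
have [M hM] := qfact_bounded; have [M' hM'] := iqfact_bounded.
have r0 := ltW rho_gt0; have r1 := rho_lt1.
have M0 : 0 <= M by rewrite -ler0c (le_trans _ (hM 0%N)).
have M'0 : 0 <= M' by rewrite -ler0c (le_trans _ (hM' 0)).
have qXle n : `|q ^+ n.+1| <= (rho ^+ n)%:C.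
  by rewrite norm_qX lecR exprS ler_piMl ?exprn_ge0 // ltW.
have [J1 hJ] : exists l : R[i]^o, (qfact q n : R[i]^o) @[n --> \oo] --> l.
  apply: (cvg_geometric_steps rho r0 r1 _ M) => n.
  rewrite /qfact big_nat_recr //= -/(qfact q n) mulrBr mulr1 addrAC subrr sub0r.
  by rewrite normrN normrM rmorphM ler_pM.
have [L hL] : exists l : R[i]^o, (iq n%:Z : R[i]^o) @[n --> \oo] --> l.
  apply: (cvg_geometric_steps rho r0 r1 _ M') => n.
  have -> : iq n%:Z = (1 - q ^+ n.+1) * iq n.+1%:Z.
    rewrite -[q ^+ n.+1]/(q ^ n.+1%:Z) -iqfact_pred; last exact: q_nonroot.
    by congr iq; lia.
  rewrite mulrBl mul1r opprB addrCA subrr addr0 mulrC.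
  by rewrite normrM rmorphM ler_pM.
have JL : (J1 : R[i]) * L = 1.
  have h : (qfact q n * iq n%:Z : R[i]^o) @[n --> \oo] --> (J1 * L : R[i]^o).
    exact: (cvgM hJ hL).
  have qiqE : (fun n => qfact q n * iq n%:Z) = fun=> 1.
    by apply: funext => n; rewrite /iqfact mulfV // qfact_neq0 //; exact: q_nonroot.
  move: h; rewrite [X in fmap X]qiqE => h.
  have h1 : ((1 : R[i]^o) @[_ --> \oo] --> (1 : R[i]^o)) by exact: cvg_cst.
  exact: cvg_unique h h1.
have J0 : (J1 : R[i]) != 0.
  by apply: contra_eq_neq JL => ->; rewrite mul0r eq_sym oner_eq0.
have LE : (J1 : R[i])^-1 = L by rewrite -[LHS]mulr1 -JL mulKf.
exists J1; split; [exact: J0|exact: hJ|by rewrite LE; exact: hL].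
Qed.
Lemma J1_cvg : (qfact q n : R[i]^o) @[n --> \oo] --> (J 1 q : R[i]^o).
Proof.
have [J1 [_ hJ _]] := qfact_cvg.
suff -> : J 1 q = J1 by [].
rewrite /J.
have -> : (fun n => \prod_(1 <= j < n.+1) (1 - q ^+ (1 * j)) : R[i]^o) = qfact q.
  apply: funext => n; rewrite /qfact big_add1 /=.
  by apply: eq_bigr => i _; rewrite mul1n.
exact: (cvg_lim _ hJ).
Qed.

Lemma J1_neq0 : J 1 q != 0.
Proof.
have [J1 [J0 hJ _]] := qfact_cvg.
by have -> : J 1 q = J1 := cvg_unique _ J1_cvg hJ.
Qed.

Lemma iqfact_cvg (c : int) :
  (iq (n%:Z + c) : R[i]^o) @[n --> \oo] --> ((J 1 q)^-1 : R[i]^o).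
Proof.
have [J1 [_ hJ hL]] := qfact_cvg.
have -> : J 1 q = J1 := cvg_unique _ J1_cvg hJ.
case: c => m.
  have := cvg_comp (addn^~ m) (fun n => iq n%:Z : R[i]^o) (cvg_addnr m) hL.
  by apply: cvg_trans; apply: near_eq_cvg; near=> n; rewrite /= PoszD.
rewrite -(cvg_shiftn m.+1).
have -> : (fun n => iq ((n + m.+1)%N%:Z + Negz m) : R[i]^o) = fun n => iq n%:Z.
  by apply: funext => n; congr iq; lia.
exact: hL.
Unshelve. all: by end_near. Qed.

Lemma norm_N1Xz (r : int) : `|(-1 : R[i]) ^ r| = 1.
Proof. by case: r => n; rewrite /exprz ?normfV normrX normrN1 expr1n ?invr1. Qed.

Lemma norm_alpha (e : nat) (r : int) : (e <= 1)%N ->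
  `|alpha q e 2 r| <= (rho ^+ `|r|)%:C.
Proof.
move=> e1; rewrite /alpha normrM norm_N1Xz mul1r.
set z := (tri r + _).
have zE : z * 2 = r * (r - 1) + 4 * (r * (r + e%:Z)).
  by rewrite /z mulrDl tri2; congr (_ + _); ring.
(* Here 2z = 5 r^2 + (4e - 1) r, and e <= 1 makes this at least 2 |r|. *)
have zr : `|r|%N%:Z <= z by nia.
have -> : z = `|z|%N by lia.
rewrite -exprnP norm_qX lecR ler_wiXn2l ?(ltW rho_gt0) ?(ltW rho_lt1) //; lia.
Qed.

Lemma alpha_has_sum (e : nat) : (e <= 1)%N ->
  exists g : R[i]^o, has_sum (alpha q e 2 : int -> R[i]^o) g.
Proof.
move=> e1; apply: has_sum_complex => [r|]; first exact: norm_alpha.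
exact: bounded_sums_int (ltW rho_gt0) rho_lt1.
Qed.

Lemma has_sumMr {I : choiceType} (f : I -> R[i]) (l c : R[i]) :
  has_sum (f : I -> R[i]^o) l ->
  has_sum (fun i => f i * c : R[i]^o) (l * c : R[i]^o).
Proof.
move=> fl; rewrite /has_sum.
have -> : (fun A => partial_sum (fun i => f i * c : R[i]^o) A) =
    fun A => partial_sum (f : I -> R[i]^o) A * c.
  by apply: funext => A; rewrite /partial_sum mulr_suml.
exact: (cvgM fl (cvg_cst (c : R[i]^o))).
Qed.

Lemma rogers_ramanujan (e : nat) : (e <= 1)%N ->
  has_sum (alpha q e 2 : int -> R[i]^o)
    (J 1 q * lim (series
       (fun n => q ^+ (n ^ 2 + e * n) / qpochhammer q q n : R[i]^o) @ \oo)).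
Proof.
move=> e1; have [g hg] := alpha_has_sum e e1.
have [M hM] := iqfact_bounded.
have M0 : 0 <= M by rewrite -ler0c (le_trans _ (hM 0)).
have r0 := ltW rho_gt0; have r1 := rho_lt1.
pose L := (J 1 q)^-1.
pose c (k : nat) := q ^ (k%:Z * (k%:Z + e%:Z)) * iq k%:Z.
have cE k : c k = q ^+ (k ^ 2 + e * k) / qpochhammer q q k.
  rewrite /c /iqfact (_ : k%:Z * (k%:Z + e%:Z) = (k ^ 2 + e * k)%N); last by lia.
  by congr (_ / _); apply: eq_bigr => i _; rewrite exprS.
have normqk k : `|q ^ (k%:Z * (k%:Z + e%:Z))| <= (rho ^+ k)%:C.
  have -> : k%:Z * (k%:Z + e%:Z) = (k * (k + e))%N by lia.
  by rewrite -exprnP norm_qX lecR ler_wiXn2l ?(ltW r1) //; nia.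
have c_le k : `|c k| <= (M * rho ^+ k)%:C.
  by rewrite /c mulrC normrM rmorphM ler_pM.
have [S hS] : exists S : R[i]^o, has_sum (c : nat -> R[i]^o) S.
  apply: (has_sum_complex _ _ c_le).
  exact: (bounded_sumsZ _ _ M0 (bounded_sums_nat _ r0 r1)).
have serE : lim (series
   (fun n => q ^+ (n ^ 2 + e * n) / qpochhammer q q n : R[i]^o) @ \oo) = S.
  have h : (\sum_(k <- iota 0 n) c k : R[i]^o) @[n --> \oo] --> S.
    apply: (has_sum_seq _ _ _ _ _ hS) => [n|i]; first by rewrite iota_uniq.
    by exists i.+1 => // n /= ?; rewrite mem_iota.
  have -> : series (fun n => q ^+ (n ^ 2 + e * n) / qpochhammer q q n : R[i]^o) =
      fun n => \sum_(k <- iota 0 n) c k.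
    apply: funext => n; rewrite /series /= /index_iota subn0.
    by apply: eq_bigr => k _; exact/esym/cE.
  exact: (cvg_lim _ h).
rewrite serE.
(* The smallest box allowed by [finite_rogers_ramanujan]. *)
pose N n := (n + e).+1.
(* Both inverse factorials tend to L = 1 / J_1, with majorant M^2 rho^|r|. *)
have lhs : (\sum_(r <- boxZ (N n))
    alpha q e 2 r * iq (n%:Z - r) * iq (n%:Z + r + e%:Z) : R[i]^o)
    @[n --> \oo] --> (g * L * L : R[i]^o).
  apply: (tannery _ (fun r => alpha q e 2 r * L * L) (fun r => M * M * rho ^+ `|r|)).
  - move=> n r; rewrite -mulrA mulrC !rmorphM normrM.
    by rewrite ler_pM ?norm_alpha // normrM ler_pM.
  - exact: (bounded_sumsZ _ _ (mulr_ge0 M0 M0) (bounded_sums_int _ r0 r1)).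
  - move=> r.
    have h1 := iqfact_cvg (- r).
    have h2 : (iq (n%:Z + r + e%:Z) : R[i]^o) @[n --> \oo] --> (L : R[i]^o).
      by under eq_fun do rewrite -addrA; exact: iqfact_cvg.
    exact: (cvgM (cvgM (cvg_cst (alpha q e 2 r : R[i]^o)) h1) h2).
  - by move=> n; rewrite boxZ_uniq.
  - by move=> r; apply: boxZ_cofinal => n; rewrite /N; lia.
  exact/has_sumMr/has_sumMr.
(* Only 1 / (q)_(n-k) depends on n, and it tends to L. Comparing limits gives g L^2 = S L, hence g =
   J_1 S. *)
have rhs : (\sum_(k <- iota 0 n.+1)
    q ^ (k%:Z * (k%:Z + e%:Z)) * iq (n%:Z - k%:Z) * iq k%:Z : R[i]^o)
    @[n --> \oo] --> (S * L : R[i]^o).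
  apply: (tannery _ (fun k => c k * L) (fun k => M * (M * rho ^+ k))).
  - move=> n k; rewrite mulrAC -/(c k) mulrC normrM (rmorphM _ M) ler_pM //.
  - apply: (bounded_sumsZ _ _ M0).
    exact: (bounded_sumsZ _ _ M0 (bounded_sums_nat _ r0 r1)).
  - move=> k; have h1 := iqfact_cvg (- k%:Z).
    have -> : (fun n : nat => q ^ (k%:Z * (k%:Z + e%:Z)) * iq (n%:Z - k%:Z) * iq k%:Z
        : R[i]^o) = fun n => c k * iq (n%:Z - k%:Z).
      by apply: funext => n; rewrite mulrAC.
    exact: (cvgM (cvg_cst (c k : R[i]^o)) h1).
  - by move=> n; rewrite iota_uniq.
  - by move=> i; exists i => // n /= ?; rewrite -/(iota 0 n.+1) mem_iota.
  exact: has_sumMr.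
have L0 : L != 0 by rewrite invr_eq0 J1_neq0.
have E : g * L * L = S * L.
  have sE : (fun n => \sum_(r <- boxZ (N n))
      alpha q e 2 r * iq (n%:Z - r) * iq (n%:Z + r + e%:Z) : R[i]^o) =
    fun n => \sum_(k <- iota 0 n.+1)
      q ^ (k%:Z * (k%:Z + e%:Z)) * iq (n%:Z - k%:Z) * iq k%:Z.
    apply: funext => n.
    have := finite_rogers_ramanujan q q_nonroot q_neq0 e n (N n) e1 (leqnn _).
    by rewrite /bailey_sum /index_iota subn0.
  move: lhs; rewrite [X in fmap X]sE => lhs.
  exact: cvg_unique lhs rhs.
have -> : J 1 q * S = g.
  apply: (mulIf L0); rewrite mulrC mulrA mulVf ?J1_neq0 // mul1r.
  by apply: (mulIf L0).
exact: hg.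
Qed.

End RogersRamanujan.

(** * Sums over lattices *)

Definition line_coef (a : int) (x y : int) : int := (x == a * y %[mod 20])%Z.

(** At x = 10 m + a, y = 10 n + b this is (-1)^(m+n), written so that it visibly depends on x and y
    mod 20 only. *)
Definition odd_coef (a b : int) (x y : int) : int :=
  if (x == a %[mod 10])%Z && (y == b %[mod 10])%Z then
    (if (x + y == a + b %[mod 20])%Z then 1 else -1) else 0.

Definition periodic20 (c : int -> int -> int) :=
  forall x y i j, c (x * 20 + i) (y * 20 + j) = c i j.

Lemma line_coef_periodic a : periodic20 (line_coef a).
Proof.
move=> x y i j; rewrite /line_coef.
have -> : a * (y * 20 + j) = (a * y) * 20 + a * j by ring.
by rewrite !modzMDl.
Qed.

Lemma odd_coef_periodic a b : periodic20 (odd_coef a b).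
Proof.
move=> x y i j; rewrite /odd_coef.
have -> : x * 20 + i = (x * 2) * 10 + i by ring.
have -> : y * 20 + j = (y * 2) * 10 + j by ring.
rewrite !modzMDl.
have -> : (x * 2) * 10 + i + ((y * 2) * 10 + j) = (x + y) * 20 + (i + j) by ring.
by rewrite modzMDl.
Qed.

(** Both sides have period 20 in x and in y, which leaves 400 residue pairs to be checked by
    computation. *)
Lemma lattice_coef (x y : int) :
  line_coef 3 x y + line_coef 3 x (- y)
    - (line_coef 13 x y + line_coef 13 x (- y)) =
  (odd_coef 3 (-1) x y + odd_coef 3 (-1) x (- y)
    + odd_coef 3 (-1) (- x) y + odd_coef 3 (-1) (- x) (- y)) -
  (odd_coef (-1) 3 x y + odd_coef (-1) 3 x (- y)
    + odd_coef (-1) 3 (- x) y + odd_coef (-1) 3 (- x) (- y)).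
Proof.
have [a [i [i20 ->]]] : exists (a : int) (i : nat), (i < 20)%N /\ x = a * 20 + i%:Z.
  by exists (x %/ 20)%Z, (absz (x %% 20)%Z); lia.
have [b [j [j20 ->]]] : exists (b : int) (j : nat), (j < 20)%N /\ y = b * 20 + j%:Z.
  by exists (y %/ 20)%Z, (absz (y %% 20)%Z); lia.
(* Reflected arguments are first brought to the form (- a) 20 - i, so that periodicity applies to
   them as well. *)
rewrite !opprD -!mulNr !line_coef_periodic !odd_coef_periodic.
apply/eqP; have {}i20 : i \in iota 0 20 by rewrite mem_iota.
have {}j20 : j \in iota 0 20 by rewrite mem_iota.
move: j j20; apply/allP; move: i i20; apply/allP.
by vm_compute.
Qed.

Lemma odd_coef_on (a b m n : int) :
  odd_coef a b (m * 10 + a) (n * 10 + b) = if (2 %| m + n)%Z then 1 else -1.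
Proof.
rewrite /odd_coef !modzMDl !eqxx /=; congr (if _ then _ else _).
have -> : m * 10 + a + (n * 10 + b) = (m + n) * 10 + (a + b) by ring.
by rewrite eqz_mod_dvd addrK; lia.
Qed.

Lemma expN1z {F : fieldType} (r : int) :
  (-1 : F) ^ r = if (2 %| r)%Z then 1 else -1.
Proof.
have sq1 : (-1 : F) ^ (2 : int) = 1 by rewrite -[LHS]/((-1) ^+ 2) sqrrN expr1n.
have [h|h] := boolP (2 %| r)%Z.
  by rewrite -(divzK h) mulrC -exprz_exp sq1 exp1rz.
have -> : r = 2 * (r %/ 2)%Z + 1 by lia.
by rewrite expfzDr ?oppr_eq0 ?oner_eq0 // -exprz_exp sq1 exp1rz mul1r expr1z.
Qed.

Lemma floor_form (x y : int) : exists n : nat,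
  ((x ^+ 2 + 31 * y ^+ 2) %/ 40)%Z = n%:Z /\ (`|x| + `|y| <= 40 * n + 39)%N.
Proof.
have sq_ge (t : int) : `|t|%N%:Z <= t ^+ 2 by rewrite expr2; nia.
have := sq_ge x; have := sq_ge y; move: (x ^+ 2) (y ^+ 2) => x2 y2 hy hx.
by exists (absz ((x2 + 31 * y2) %/ 40)%Z); split; lia.
Qed.

(** * Weighted sums of q^((x^2 + 31 y^2) / 40) *)

Section LatticeSums.
Context {R : realType} (q : R[i]).
Local Notation rho := (complex.Re `|q|).

(** The quotient is a floor, which gives a total function; it is exact on the supports of the
    coefficients that occur. *)
Definition lattice_term (c : int -> int -> int) (w : int * int) : R[i]^o :=
  (c w.1 w.2)%:~R * q ^ ((w.1 ^+ 2 + 31 * w.2 ^+ 2) %/ 40)%Z.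

Lemma lattice_term_neq0 c w : lattice_term c w != 0 -> c w.1 w.2 != 0.
Proof. by apply: contra_neq => c0; rewrite /lattice_term c0 mul0r. Qed.

Lemma lattice_term_summable c : q != 0 -> `|q| < 1 ->
  (forall x y, `|c x y| <= 1) ->
  exists l : R[i]^o, has_sum (lattice_term c) l.
Proof.
move=> q_neq0 q_lt1 c1.
have r0 := rho_gt0 q q_neq0; have r1 := rho_lt1 q q_lt1.
(* Bernoulli: s is an explicit majorant of the 40th root of |q|. *)
pose s := 1 - (1 - rho) / 40.
have s0 : 0 < s by rewrite /s; lra.
have s1 : s < 1 by rewrite /s; lra.
have rs : rho <= s ^+ 40.
  have bern n : (n <= 40)%N -> 1 - n%:R * ((1 - rho) / 40) <= s ^+ n.
    elim: n => [_|n IH n40]; first by rewrite expr0 mul0r subr0.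
    rewrite exprS -natr1; have := IH (ltnW n40) => {}IH.
    apply: (@le_trans _ _ (s * (1 - n%:R * ((1 - rho) / 40)))); last first.
      by rewrite ler_pM2l.
    have : 0 <= n%:R * ((1 - rho) / 40) * ((1 - rho) / 40).
      by rewrite !mulr_ge0 ?invr_ge0 ?subr_ge0 ?(ltW r1).
    by rewrite /s; lra.
  by apply: le_trans (bern 40%N (leqnn _)); lra.
apply: (has_sum_complex _ (fun w => s ^- 39 * s ^+ (`|w.1| + `|w.2|))) => [[x y]|].
  rewrite /lattice_term /= normrM.
  have -> : `|(c x y)%:~R : R[i]| = `|c x y|%:~R by rewrite intr_norm.
  have cC : `|c x y|%:~R <= 1 :> R[i] by rewrite -(mulr1z 1) ler_int.
  rewrite -[X in _ <= X]mul1r ler_pM //.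
  (* Since rho <= s^40 and |x| + |y| <= 40 n + 39, rho^n <= s^(40 n) <= s^(-39) s^(|x| + |y|); the
     39 is the largest remainder of the floor. *)
  have [n [-> xy_le]] := floor_form x y.
  rewrite -exprnP norm_qX lecR.
  have sz : rho ^+ n <= s ^+ (40 * n).
    by rewrite exprM; apply: lerXn2r; rewrite ?nnegrE ?exprn_ge0 // ltW.
  apply: (le_trans sz); rewrite mulrC ler_pdivlMr ?exprn_gt0 // -exprD.
  by rewrite ler_wiXn2l ?(ltW s0) ?(ltW s1) // addnC.
apply: (bounded_sumsZ _ _ _ (bounded_sums_int2 _ (ltW s0) s1)).
by rewrite invr_ge0 exprn_ge0 // ltW.
Qed.

Lemma lattice_termD c d l m :
  has_sum (lattice_term c) l -> has_sum (lattice_term d) m ->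
  has_sum (lattice_term (fun x y => c x y + d x y)) (l + m).
Proof.
move=> cl dm.
have -> : lattice_term (fun x y => c x y + d x y) =
    fun w => lattice_term c w + lattice_term d w.
  by apply: funext => w; rewrite /lattice_term intrD mulrDl.
exact: has_sumD.
Qed.

Lemma lattice_termB c d l m :
  has_sum (lattice_term c) l -> has_sum (lattice_term d) m ->
  has_sum (lattice_term (fun x y => c x y - d x y)) (l - m).
Proof.
move=> cl dm.
have -> : lattice_term (fun x y => c x y - d x y) =
    fun w => lattice_term c w - lattice_term d w.
  by apply: funext => w; rewrite /lattice_term intrB mulrBl.
exact: has_sumB.
Qed.

(** The exponent is even in y, so a reflection permutes the terms. This and its analogue in x
    justify averaging over signs. *)
Lemma lattice_term_oppr c l : has_sum (lattice_term c) l ->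
  has_sum (lattice_term (fun x y => c x (- y))) l.
Proof.
pose h (w : int * int) := (w.1, - w.2).
have hK : involutive h by case=> x y; rewrite /h opprK.
move=> /(has_sum_reindex _ _ h (inv_inj hK)) cl.
have -> : lattice_term (fun x y => c x (- y)) = lattice_term c \o h.
  by apply: funext => w; rewrite /lattice_term /= sqrrN.
by apply: cl => i _; exists (h i); rewrite hK.
Qed.

Lemma lattice_term_oppl c l : has_sum (lattice_term c) l ->
  has_sum (lattice_term (fun x y => c (- x) y)) l.
Proof.
pose h (w : int * int) := (- w.1, w.2).
have hK : involutive h by case=> x y; rewrite /h opprK.
move=> /(has_sum_reindex _ _ h (inv_inj hK)) cl.
have -> : lattice_term (fun x y => c (- x) y) = lattice_term c \o h.
  by apply: funext => w; rewrite /lattice_term /= sqrrN.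
by apply: cl => i _; exists (h i); rewrite hK.
Qed.

Lemma line_coef_le1 a x y : `|line_coef a x y| <= 1.
Proof. by rewrite /line_coef; case: (_ == _). Qed.

Lemma odd_coef_le1 a b x y : `|odd_coef a b x y| <= 1.
Proof. by rewrite /odd_coef; case: ifP => //; case: ifP. Qed.

(* x = 3 u + 17 v, y = u - v gives x^2 + 31 y^2 = 40 (u^2 + u v + 8 v^2). *)
Lemma theta118_sum l : has_sum (lattice_term (line_coef 3)) l ->
  has_sum (fun w : int * int =>
    q ^ (1 * w.1 ^+ 2 + 1 * w.1 * w.2 + 8 * w.2 ^+ 2) : R[i]^o) l.
Proof.
pose h (w : int * int) := (3 * w.1 + 17 * w.2, w.1 - w.2).
have hI : injective h by case=> u v [u' v'] [] ? ?; congr (_, _); lia.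
move=> /(has_sum_reindex _ _ h hI) cl.
have /cl : forall i, lattice_term (line_coef 3) i != 0 -> exists j, i = h j.
  case=> x y /lattice_term_neq0; rewrite /line_coef /=.
  have [xy _|//] := boolP (x == 3 * y %[mod 20])%Z.
  (* Inverting [h]: x - 3 y = 20 v and u = y + v. *)
  exists (y + ((x - 3 * y) %/ 20)%Z, ((x - 3 * y) %/ 20)%Z).
  by congr (_, _); rewrite /=; lia.
suff -> : (fun w : int * int =>
    q ^ (1 * w.1 ^+ 2 + 1 * w.1 * w.2 + 8 * w.2 ^+ 2) : R[i]^o) =
  lattice_term (line_coef 3) \o h by [].
apply: funext => -[u v]; rewrite /lattice_term /=.
have -> : line_coef 3 (3 * u + 17 * v) (u - v) = 1.
  by rewrite /line_coef (_ : _ == _) //; lia.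
rewrite mulr1z [RHS]mul1r; congr (q ^ _); apply/esym.
have -> : (3 * u + 17 * v) ^+ 2 + 31 * (u - v) ^+ 2 =
  (1 * u ^+ 2 + 1 * u * v + 8 * v ^+ 2) * 40 by ring.
by rewrite mulzK.
Qed.

(* x = 7 u - 6 v, y = - u - 2 v gives x^2 + 31 y^2 = 40 (2 u^2 + u v + 4 v^2). *)
Lemma theta214_sum l : has_sum (lattice_term (line_coef 13)) l ->
  has_sum (fun w : int * int =>
    q ^ (2 * w.1 ^+ 2 + 1 * w.1 * w.2 + 4 * w.2 ^+ 2) : R[i]^o) l.
Proof.
pose h (w : int * int) := (7 * w.1 - 6 * w.2, - w.1 - 2 * w.2).
have hI : injective h by case=> u v [u' v'] [] ? ?; congr (_, _); lia.
move=> /(has_sum_reindex _ _ h hI) cl.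
have /cl : forall i, lattice_term (line_coef 13) i != 0 -> exists j, i = h j.
  case=> x y /lattice_term_neq0; rewrite /line_coef /=.
  have [xy _|//] := boolP (x == 13 * y %[mod 20])%Z.
  (* Inverting [h]: x + 7 y = -20 v, and 20 divides x + 7 y because x = 13 y mod 20. *)
  pose v := (- (x + 7 * y) %/ 20)%Z.
  exists (- y - 2 * v, v); rewrite /h /=.
  by congr (_, _); rewrite /v; lia.
suff -> : (fun w : int * int =>
    q ^ (2 * w.1 ^+ 2 + 1 * w.1 * w.2 + 4 * w.2 ^+ 2) : R[i]^o) =
  lattice_term (line_coef 13) \o h by [].
apply: funext => -[u v]; rewrite /lattice_term /=.
have -> : line_coef 13 (7 * u - 6 * v) (- u - 2 * v) = 1.
  by rewrite /line_coef (_ : _ == _) //; lia.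
rewrite mulr1z [RHS]mul1r; congr (q ^ _); apply/esym.
have -> : (7 * u - 6 * v) ^+ 2 + 31 * (- u - 2 * v) ^+ 2 =
  (2 * u ^+ 2 + 1 * u * v + 4 * v ^+ 2) * 40 by ring.
by rewrite mulzK.
Qed.

(* 40 (r (r - 1) / 2 + 2 r (r + e)) + (4 e - 1)^2 = (10 r + 4 e - 1)^2. *)
Lemma odd_coef_sum (a b : int) (e e' d : nat) (g g' l : R[i]) :
  q != 0 -> a = 4 * e%:Z - 1 -> b = 4 * e'%:Z - 1 ->
  40 * d%:Z = a ^+ 2 + 31 * b ^+ 2 ->
  has_sum (alpha q e 2 : int -> R[i]^o) g ->
  has_sum (alpha (q ^+ 31) e' 2 : int -> R[i]^o) g' ->
  has_sum (lattice_term (odd_coef a b)) l ->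
  l = q ^+ d * (g * g').
Proof.
move=> q_neq0 aE bE dE hg hg'.
pose h (w : int * int) := (w.1 * 10 + a, w.2 * 10 + b).
have hI : injective h by case=> u v [u' v'] [] ? ?; congr (_, _); lia.
move=> /(has_sum_reindex _ _ h hI) cl.
have /cl {}cl : forall i, lattice_term (odd_coef a b) i != 0 -> exists j, i = h j.
  case=> x y /lattice_term_neq0; rewrite /odd_coef /=.
  case: ifP => [/andP[/eqP xa /eqP yb] _|//].
  exists (((x - a) %/ 10)%Z, ((y - b) %/ 10)%Z); rewrite /h /=.
  by congr (_, _); lia.
have termE w : (lattice_term (odd_coef a b) \o h) w =
    (q ^+ d * alpha q e 2 w.1) * alpha (q ^+ 31) e' 2 w.2.
  case: w => m n; rewrite /lattice_term /= odd_coef_on.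
  have -> : (if (2 %| m + n)%Z then 1 else -1 : int)%:~R = (-1) ^ (m + n) :> R[i].
    by rewrite expN1z; case: ifP.
  rewrite /alpha; set z := (tri m + _); set z' := (tri n + _).
  have zE : z * 2 = m * (m - 1) + 4 * (m * (m + e%:Z)).
    by rewrite /z mulrDl tri2; congr (_ + _); ring.
  have zE' : z' * 2 = n * (n - 1) + 4 * (n * (n + e'%:Z)).
    by rewrite /z' mulrDl tri2; congr (_ + _); ring.
  have -> : (m * 10 + a) ^+ 2 + 31 * (n * 10 + b) ^+ 2 = (d%:Z + z + 31 * z') * 40.
    apply: (@mulIf _ (2 : int)) => //.
    have -> : (d%:Z + z + 31 * z') * 40 * 2 =
        40 * d%:Z * 2 + 40 * (z * 2) + 1240 * (z' * 2).
      by ring.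
    by rewrite dE zE zE' aE bE; ring.
  rewrite mulzK //.
  have -> : q ^ (d%:Z + z + 31 * z') = q ^+ d * q ^ z * (q ^+ 31) ^ z'.
    by rewrite [q ^ (_ + _ * _)]expfzDr // [q ^ (_ + z)]expfzDr // -exprz_exp.
  by rewrite expfzDr ?oppr_eq0 ?oner_eq0 //; ring.
(* Along square boxes the double sum factors into two single sums, so its limit is also the product
   of theirs. *)
have h1 := has_sum_seq _ _ _ boxZ2_uniq boxZ2_cofinal cl.
have h2 : ((q ^+ d * \sum_(r <- boxZ n) alpha q e 2 r) *
    \sum_(r <- boxZ n) alpha (q ^+ 31) e' 2 r : R[i]^o) @[n --> \oo] -->
    ((q ^+ d * g) * g' : R[i]^o).
  have bc r := @boxZ_cofinal r id (fun=> leqnn _).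
  exact: (cvgM (cvgM (cvg_cst (q ^+ d : R[i]^o)) (has_sum_seq _ _ _ boxZ_uniq bc hg))
    (has_sum_seq _ _ _ boxZ_uniq bc hg')).
rewrite mulrA.
have sE : (fun n => \sum_(w <- boxZ2 n) (lattice_term (odd_coef a b) \o h) w) =
  fun n => (q ^+ d * \sum_(r <- boxZ n) alpha q e 2 r) *
    \sum_(r <- boxZ n) alpha (q ^+ 31) e' 2 r.
  apply: funext => n; rewrite (eq_bigr _ (fun w _ => termE w)).
  rewrite (sum_boxZ2 (fun r => q ^+ d * alpha q e 2 r) (alpha (q ^+ 31) e' 2)).
  by rewrite -mulr_sumr.
move: h1; rewrite [X in fmap X]sE => h1.
exact: cvg_unique h1 h2.
Qed.

End LatticeSums.

(** * Powers of the nome *)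

Section Nome.
Context {R : realType}.
Implicit Types (tau : R[i]) (a b c : R).

Lemma cexpD (z w : R[i]) : cexp (z + w) = cexp z * cexp w.
Proof.
rewrite /cexp; case: z w => [a b] [c d] /=.
rewrite expRD cosD sinD; apply/eqP; rewrite eq_complex /=.
by apply/andP; split; apply/eqP; ring.
Qed.

Lemma qpowD a b tau : qpow (a + b) tau = qpow a tau * qpow b tau.
Proof.
have E : 0 +i* (2 * pi * (a + b)) = (0 +i* (2 * pi * a)) + (0 +i* (2 * pi * b)) :> R[i].
  by apply/eqP; rewrite eq_complex /=; apply/andP; split; apply/eqP; ring.
by rewrite /qpow E mulrDl cexpD.
Qed.

Lemma qpow0 tau : qpow 0 tau = 1.
Proof.
rewrite /qpow mulr0 -/(0 : R[i]) mul0r /cexp /= expR0 cos0 sin0.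
by apply/eqP; rewrite eq_complex /= !mul0r !mulr0 !mul1r subr0 addr0 !eqxx.
Qed.

(** The inverse is [qpow (- a) tau]. *)
Lemma qpow_neq0 a tau : qpow a tau != 0.
Proof.
apply/eqP => q0; have := qpowD a (- a) tau.
by rewrite subrr qpow0 q0 mul0r => /eqP; rewrite oner_eq0.
Qed.

Lemma nome_exp n tau : nome tau ^+ n = qpow n%:R tau.
Proof.
elim: n => [|n IH]; first by rewrite qpow0.
by rewrite exprS IH -natr1 addrC qpowD.
Qed.

Lemma qpow_scale c n tau : qpow c (n%:R * tau) = qpow (c * n%:R) tau.
Proof.
have E : (0 +i* (2 * pi * c)) * n%:R = 0 +i* (2 * pi * (c * n%:R)) :> R[i].
  rewrite -(rmorph_nat (real_complex R)).
  by apply/eqP; rewrite eq_complex /=; apply/andP; split; apply/eqP; ring.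
by rewrite /qpow mulrA E.
Qed.

Lemma norm_nome_lt1 tau : 0 < complex.Im tau -> `|nome tau| < 1.
Proof.
case: tau => a b /= b0.
rewrite /nome /qpow /cexp normrM !normc_def /= cos2Dsin2 sqrtr1.
rewrite (_ : 1%:C = 1) // !mulr1 expr0n addr0 sqrtr_sqr ger0_norm ?expR_ge0 //.
rewrite ltcE /= eqxx expR_lt1 mul0r sub0r oppr_lt0.
by rewrite !mulr_gt0 ?pi_gt0.
Qed.

End Nome.

(** * Theta series of the Rogers-Ramanujan functions and infinite products *)

Lemma rrG_theta {R : realType} (q : R[i]) : q != 0 -> `|q| < 1 ->
  has_sum (alpha q 0 2 : int -> R[i]^o) (J 1 q * rrG q).
Proof.
move=> q0 q1; have := rogers_ramanujan q q0 q1 0 isT.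
have -> : (fun n => q ^+ (n ^ 2 + 0 * n) / qpochhammer q q n : R[i]^o) =
    fun n => q ^+ (n ^ 2) / qpochhammer q q n.
  by apply: funext => n; rewrite mul0n addn0.
by [].
Qed.

Lemma rrH_theta {R : realType} (q : R[i]) : q != 0 -> `|q| < 1 ->
  has_sum (alpha q 1 2 : int -> R[i]^o) (J 1 q * rrH q).
Proof.
move=> q0 q1; have := rogers_ramanujan q q0 q1 1 isT.
have -> : (fun n => q ^+ (n ^ 2 + 1 * n) / qpochhammer q q n : R[i]^o) =
    fun n => q ^+ (n ^ 2 + n) / qpochhammer q q n.
  by apply: funext => n; rewrite mul1n.
by [].
Qed.

Lemma J_exp {R : realType} (q : R[i]) d : J 1 (q ^+ d) = J d q.
Proof.
rewrite /J.
have -> : (fun n => \prod_(1 <= j < n.+1) (1 - (q ^+ d) ^+ (1 * j)) : R[i]^o) =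
    fun n => \prod_(1 <= j < n.+1) (1 - q ^+ (d * j)).
  by apply: funext => n; apply: eq_bigr => j _; rewrite -exprM mul1n.
by [].
Qed.

Lemma eta_J {R : realType} (tau : R[i]) :
  Defs.eta tau = qpow 24^-1 tau * J 1 (nome tau).
Proof.
have E : (fun n => \prod_(1 <= j < n.+1) (1 - nome tau ^+ j) : R[i]^o) =
    fun n => \prod_(1 <= j < n.+1) (1 - nome tau ^+ (1 * j)).
  by apply: funext => n; apply: eq_bigr => j _; rewrite mul1n.
by rewrite /Defs.eta E.
Qed.

(** * The product formulas for f_31 and Phi *)

Lemma f31_product {R : realType} (tau : R[i]) : 0 < complex.Im tau ->
  let q := nome tau in f31 tau = q * J 1 q * J 31 q * U1_31 q.
Proof.
move=> t0 q.
have q0 : q != 0 := qpow_neq0 _ _.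
have q1 : `|q| < 1 := norm_nome_lt1 tau t0.
have Q0 : q ^+ 31 != 0 by rewrite expf_neq0.
have Q1 : `|q ^+ 31| < 1 by rewrite normrX exprn_ilt1.
have hG := rrG_theta q q0 q1.
have hH := rrH_theta q q0 q1.
have hG31 := rrG_theta _ Q0 Q1.
have hH31 := rrH_theta _ Q0 Q1.
rewrite J_exp in hG31 hH31.
have [l1 hl1] := lattice_term_summable q _ q0 q1 (line_coef_le1 3).
have [l2 hl2] := lattice_term_summable q _ q0 q1 (line_coef_le1 13).
have [s1 hs1] := lattice_term_summable q _ q0 q1 (odd_coef_le1 3 (-1)).
have [s2 hs2] := lattice_term_summable q _ q0 q1 (odd_coef_le1 (-1) 3).
have T1 : Theta 1 1 8 tau = l1 := sum_has_sum _ _ (theta118_sum q _ hl1).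
have T2 : Theta 2 1 4 tau = l2 := sum_has_sum _ _ (theta214_sum q _ hl2).
(* The residue 4e - 1 is 3 for the H series and -1 for the G series. The prefactors are q^1 and q^7,
   as 9 + 31 = 40 and 1 + 279 = 280; their ratio is the q^6 of U(1, 31). *)
have S1 := odd_coef_sum q 3 (-1) 1 0 1 _ _ _ q0 erefl erefl erefl hH hG31 hs1.
have S2 := odd_coef_sum q (-1) 3 0 1 7 _ _ _ q0 erefl erefl erefl hG hH31 hs2.
(* Summation of [lattice_coef]: reflected coefficients have the same sums, so 2 (l1 - l2) = 4 (s1 -
   s2). *)
have E : l1 + l1 - (l2 + l2) = (s1 + s1 + s1 + s1) - (s2 + s2 + s2 + s2).
  have hl := lattice_termB q _ _ _ _
    (lattice_termD q _ _ _ _ hl1 (lattice_term_oppr q _ _ hl1))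
    (lattice_termD q _ _ _ _ hl2 (lattice_term_oppr q _ _ hl2)).
  have four c s (hs : has_sum (lattice_term q c) s) :=
    lattice_termD q _ _ _ _ (lattice_termD q _ _ _ _ (lattice_termD q _ _ _ _ hs
      (lattice_term_oppr q _ _ hs)) (lattice_term_oppl q _ _ hs))
      (lattice_term_oppr q _ _ (lattice_term_oppl q _ _ hs)).
  have hs := lattice_termB q _ _ _ _ (four _ _ hs1) (four _ _ hs2).
  apply: (has_sum_unique _ _ _ hl).
  suff <- : lattice_term q (fun x y =>
   (odd_coef 3 (-1) x y + odd_coef 3 (-1) x (- y)
    + odd_coef 3 (-1) (- x) y + odd_coef 3 (-1) (- x) (- y)) -
  (odd_coef (-1) 3 x y + odd_coef (-1) 3 x (- y)
    + odd_coef (-1) 3 (- x) y + odd_coef (-1) 3 (- x) (- y))) =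
   lattice_term q (fun x y => line_coef 3 x y + line_coef 3 x (- y)
    - (line_coef 13 x y + line_coef 13 x (- y))) by [].
  by congr lattice_term; apply: funext => x; apply: funext => y; rewrite lattice_coef.
rewrite /f31 T1 T2.
have -> : (l1 - l2 : R[i]) / 2 = s1 - s2.
  have {}E : 2 * (l1 - l2 : R[i]) = 4 * (s1 - s2).
    have -> : 2 * (l1 - l2 : R[i]) = l1 + l1 - (l2 + l2) by ring.
    by rewrite E; ring.
  have four_neq0 : (4 : R[i]) != 0 by rewrite pnatr_eq0.
  by apply: (mulfI four_neq0); rewrite -E; field.
rewrite S1 S2 /U1_31.
move: (J 1 q) (J 31 q) (rrG q) (rrH q) (rrG _) (rrH _).
move: q {q0 q1 Q0 Q1 hG hH hG31 hH31 hl1 hl2 hs1 hs2 T1 T2 S1 S2}.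
by move=> p j j' g h g' h'; ring.
Qed.

Theorem proposition3p1 (R : realType) (tau : R[i])
    (tau_upper : 0 < complex.Im tau) :
  let q := nome tau in
  f31 tau = q * J 1 q * J 31 q * U1_31 q /\
  Phi tau = qpow (- 3^-1) tau * U1_31 q.
Proof.
move=> q; have fE := f31_product tau tau_upper; split; first exact: fE.
have q0 : q != 0 := qpow_neq0 _ _.
have q1 : `|q| < 1 := norm_nome_lt1 tau tau_upper.
have Q0 : q ^+ 31 != 0 by rewrite expf_neq0.
have Q1 : `|q ^+ 31| < 1 by rewrite normrX exprn_ilt1.
have J0 := J1_neq0 q q0 q1; have := J1_neq0 _ Q0 Q1.
rewrite J_exp => J310.
have nome31 : nome (31 * tau) = q ^+ 31.
  by rewrite nome_exp /nome qpow_scale mul1r.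
rewrite /Phi fE !eta_J nome31 J_exp qpow_scale -/q.
(* The two eta prefactors contribute 1/24 + 31/24 = 4/3, which leaves -1/3 of the exponent 1 of
   q. *)
have qE : q = qpow (- 3^-1) tau * (qpow 24^-1 tau * qpow (24^-1 * 31%:R) tau).
  rewrite -[qpow 24^-1 tau * _]qpowD -qpowD.
  have -> : - 3^-1 + (24^-1 + 24^-1 * 31%:R) = 1 :> R by field.
  by [].
have := qpow_neq0 24^-1 tau; have := qpow_neq0 (24^-1 * 31%:R) tau.
rewrite {1}qE.
move: (qpow 24^-1 tau) (qpow _ tau) (qpow _ tau) J0 J310 => x y z.
move: (J 1 q) (J 31 q) (U1_31 q) => j j' u j0 j'0 y0 x0.
by field; rewrite x0 y0 j0 j'0.
Qed.
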